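(* Let $G$ be a graph of order $n$ and let $k$ be an integer with $1\leq 2k\leq \delta(G)$. Then $\gamma_{\times 2k,t}(G_I)=2kn$ if and only if $G$ is a $k$-Hamiltonian-like decomposable graph.
   Context: All graphs are finite, simple and undirected. For a graph $G$ without isolated vertices, the inflated graph $G_I$ is obtained as follows: each vertex $x_i$ of $G$ of degree $d(x_i)$ is replaced by a clique $X_i\cong K_{d(x_i)}$ whose vertices are labelled $x_ix_j$, one for each neighbour $x_j$ of $x_i$; and each edge $x_ix_j$ of $G$ is replaced by the edge joining $x_ix_j\in X_i$ to $x_jx_i\in X_j$. For an integer $k\geq1$, a set $S\subseteq V(H)$ is a $k$-tuple total dominating set of a graph $H$ if every vertex of $H$ has at least $k$ neighbours in $S$; $\gamma_{\times k,t}(H)$ denotes the minimum cardinality of such a set. A subgraph of $G$ is Hamiltonian if it contains a cycle through all of its vertices (a Hamiltonian cycle). A Hamiltonian-like decomposition of $G$ is a family of pairwise vertex-disjoint Hamiltonian subgraphs $G_1,\dots,G_t$ of $G$ with $V(G)=V(G_1)\cup\dots\cup V(G_t)$. For an integer $k\geq 1$, $G$ is a $k$-Hamiltonian-like decomposable graph (kHLD-graph) if there are $k$ Hamiltonian-like decompositions $G_1^{(i)},\dots,G_{t_i}^{(i)}$ ($1\leq i\leq k$) of $G$, together with a Hamiltonian cycle $C_s^{(i)}$ of each $G_s^{(i)}$, such that for any two distinct Hamiltonian subgraphs $G_s^{(i)}$ and $G_r^{(j)}$ in these decompositions the cycles $C_s^{(i)}$ and $C_r^{(j)}$ are disjoint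 (share no edge). *)

(* Defs.v *)
From mathcomp Require Import all_boot.

Set Implicit Arguments.
Unset Strict Implicit.
Unset Printing Implicit Defensive.

Record sgraph := SGraph {
  vertex :> finType;
  edge : rel vertex;
  edge_sym : symmetric edge;
  edge_irrefl : irreflexive edge
}.

Definition degree (G : sgraph) (x : G) : nat := #|[set y : G | edge x y]|.

(* The default value #|G| exceeds every degree, so it only matters for the
   graph without vertices, which gets minimum degree 0. *)
Definition min_degree (G : sgraph) : nat :=
  \big[minn/#|G|]_(x : G) degree x.

(* The pair (x, y), with x and y adjacent, is the vertex labelled "xy" of the
   clique that replaces x. *)
Definition inflated_vertex (G : sgraph) : finType :=
  {p : G * G | edge p.1 p.2}.

(* First disjunct: two vertices of the same clique; second one: the edge
   joining "xy" to "yx". *)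
Definition inflated_edge (G : sgraph) : rel (inflated_vertex G) :=
  fun u v =>
    ((val u).1 == (val v).1) && (u != v)
    || ((val u).1 == (val v).2) && ((val u).2 == (val v).1).

Lemma inflated_edge_sym (G : sgraph) : symmetric (@inflated_edge G).
Proof.
move=> u v; rewrite /inflated_edge [v == u]eq_sym [(val v).1 == (val u).1]eq_sym.
by rewrite [(val v).1 == (val u).2]eq_sym [(val v).2 == _]eq_sym [X in _ || X]andbC.
Qed.

Lemma inflated_edge_irrefl (G : sgraph) : irreflexive (@inflated_edge G).
Proof.
move=> u; rewrite /inflated_edge !eqxx /=.
apply/negP => /andP[/eqP eq12 _].
by have := valP u; rewrite eq12 edge_irrefl.
Qed.

Definition inflation (G : sgraph) : sgraph :=
  SGraph (@inflated_edge_sym G) (@inflated_edge_irrefl G).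

Definition ktuple_total_dominating (k : nat) (H : sgraph) (S : {set H}) : bool :=
  [forall v : H, k <= #|[set u in S | edge v u]|].

(* If any set is dominating, so is the full vertex set, and then this is the
   minimum cardinality; if there is no such set, the value is the default #|H|. *)
Definition ktuple_total_domination_number (k : nat) (H : sgraph) : nat :=
  #|[arg min_(S < [set: H] | ktuple_total_dominating k S) #|S|]|.

(* Subgraphs are not assumed to be induced. *)
Record subgraph (G : sgraph) := Subgraph {
  sub_vertices : {set G};
  sub_edge : rel G;
  sub_edge_sym : symmetric sub_edge;
  sub_edgeP : forall x y, sub_edge x y ->
    [/\ x \in sub_vertices, y \in sub_vertices & edge x y]
}.

(* A cycle is given by its cyclic sequence of pairwise distinct vertices; in a
   simple graph it has at least three of them. *)
Definition hamiltonian_cycle (G : sgraph) (H : subgraph G) (c : seq G) : Prop :=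
  [/\ 2 < size c, ucycle (sub_edge H) c & c =i sub_vertices H].

Definition hamiltonian (G : sgraph) (H : subgraph G) : Prop :=
  exists c : seq G, hamiltonian_cycle H c.

Definition cycle_edges (G : sgraph) (c : seq G) : {set {set G}} :=
  [set [set x; next c x] | x in c].

Definition hamiltonian_like_decomposition
    (G : sgraph) (t : nat) (D : 'I_t -> subgraph G) : Prop :=
  [/\ forall s, hamiltonian (D s),
      forall s r, s != r -> [disjoint sub_vertices (D s) & sub_vertices (D r)]
    & \bigcup_(s < t) sub_vertices (D s) = [set: G]].

(* Two of the subgraphs D i s and D j r count as distinct when they are at
   different positions (i, s) and (j, r) of the family: the same subgraph may
   occur in several decompositions, but then with edge-disjoint Hamiltonian
   cycles. *)
Definition kHLD (k : nat) (G : sgraph) : Prop :=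
  exists (t : 'I_k -> nat)
         (D : forall i : 'I_k, 'I_(t i) -> subgraph G)
         (C : forall i : 'I_k, 'I_(t i) -> seq G),
  [/\ forall i, hamiltonian_like_decomposition (D i),
      forall i s, hamiltonian_cycle (D i s) (C i s)
    & forall (i j : 'I_k) (s : 'I_(t i)) (r : 'I_(t j)),
        Tagged (fun i => 'I_(t i)) s != Tagged (fun i => 'I_(t i)) r ->
        [disjoint cycle_edges (C i s) & cycle_edges (C j r)]].

(* Main.v *)
Require Import Defs.
From mathcomp Require Import all_boot.
From mathcomp Require Import zify.

Set Implicit Arguments.
Unset Strict Implicit.
Unset Printing Implicit Defensive.

(* A dominating set of the inflation has at least 2k vertices in each clique
   X_i, since a vertex of X_i has only one neighbour outside X_i.  When all these
   bounds are attained, the set is closed under exchanging "xy" and "yx", so it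
   is the set of ordered edges of a 2k-regular spanning subgraph F of G.  By
   Petersen's argument F splits into k sets of disjoint cycles: F has an
   orientation with in- and out-degrees k, and Hall's theorem splits the arcs of
   this orientation into the graphs of k permutations of the vertices.  An
   orientation has no two opposite arcs, so the orbits of these permutations
   have length at least three and are cycles of G. *)

(** * Hall's theorem and regular relations *)

Definition hall_condition (T : finType) (N : T -> {set T}) : bool :=
  [forall B : {set T}, #|B| <= #|\bigcup_(x in B) N x|].

(* Rado's proof: if deleting y from N x and deleting z from N x both violate
   Hall's condition, submodularity of B |-> #|\bigcup_(v in B) N v| gives a
   violation for N itself. *)
Lemma hall_delete (T : finType) (N : T -> {set T}) (x y z : T) :
    hall_condition N -> y \in N x -> z \in N x -> y != z ->
  exists2 w, w \in N x &
    hall_condition (fun v => if v == x then N v :\ w else N v).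
Proof.
move=> /forallP hN Ny Nz yz.
pose N' w v := if v == x then N v :\ w else N v.
(* A violating set contains [x], because only the set of [x] has changed; taking [x] out of it turns
   the strict inequality into a weak one. *)
have bad w : ~~ hall_condition (N' w) ->
    exists2 B : {set T}, x \notin B & #|(N x :\ w) :|: \bigcup_(v in B) N v| <= #|B|.
  rewrite negb_forall => /existsP[B]; rewrite -ltnNge => hB.
  have E (C : {set T}) : x \notin C -> \bigcup_(v in C) N' w v = \bigcup_(v in C) N v.
    by move=> xC; apply: eq_bigr => v vC; rewrite /N'; case: eqP vC xC => // -> ->.
  have xB : x \in B.
    by apply: contraLR hB => xB; rewrite E // -leqNgt.
  exists (B :\ x); first by rewrite !inE eqxx.
  rewrite -ltnS; apply: leq_trans (_ : #|B| <= _); last by rewrite (cardsD1 x B) xB.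
  by move: hB; rewrite (big_setD1 x) //= E ?inE ?eqxx // {1}/N' eqxx.
have [hy|/bad[B1 xB1 h1]] := boolP (hall_condition (N' y)); first by exists y.
have [hz|/bad[B2 xB2 h2]] := boolP (hall_condition (N' z)); first by exists z.
have hU := hN (x |: (B1 :|: B2)); have hI := hN (B1 :&: B2).
move: hU; rewrite cardsU1 inE negb_or xB1 xB2 /= add1n => hU.
have := cardsUI B1 B2.
set U1 := _ :|: _ in h1; set U2 := _ :|: _ in h2.
have := cardsUI U1 U2.
have : #|\bigcup_(i in B1 :&: B2) N i| <= #|U1 :&: U2|.
  apply/subset_leq_card/bigcupsP => v /setIP[v1 v2].
  rewrite subsetI /U1 /U2; apply/andP; split.
    by apply: subset_trans (subsetUr _ _); apply: bigcup_sup.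
  by apply: subset_trans (subsetUr _ _); apply: bigcup_sup.
(* Since [y != z], the union of [U1] and [U2] recovers all of [N x], so it has more than
   [#|B1 :|: B2|] elements. As [U1 :&: U2] has at least [#|B1 :&: B2|], this contradicts [h1] and
   [h2]. *)
suff : #|\bigcup_(i in x |: (B1 :|: B2)) N i| <= #|U1 :|: U2| by lia.
apply/subset_leq_card/bigcupsP => v; rewrite !inE => /or3P[/eqP -> | v1 | v2].
- apply/subsetP => u Nu; rewrite !inE Nu !andbT.
  by case: (eqVneq u y) => //= ->; rewrite yz !orbT.
- rewrite /U1; apply: subset_trans (subsetUl _ _).
  by apply: subset_trans (subsetUr _ _); apply: bigcup_sup.
- rewrite /U2; apply: subset_trans (subsetUr _ _).
  by apply: subset_trans (subsetUr _ _); apply: bigcup_sup.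
Qed.

(** [hall_delete] shrinks the sets [N x] until all are singletons; Hall's condition for pairs then
    makes the resulting map injective. *)
Lemma hall (T : finType) (N : T -> {set T}) :
  hall_condition N -> exists2 f : T -> T, injective f & forall x, f x \in N x.
Proof.
have [m] := ubnP (\sum_x #|N x|); elim: m N => // m IH N szN hN.
have N1 x : 0 < #|N x|.
  by have /forallP/(_ [set x]) := hN; rewrite cards1 big_set1.
have [/existsP[x /card_gt1P[y [z [Ny Nz yz]]]]|] := boolP [exists x, 1 < #|N x|].
  have [w Nw hN'] := hall_delete hN Ny Nz yz.
  have [|f injf fN] := IH _ _ hN'; last first.
    exists f => // v; have := fN v; case: eqP => // _.
    by rewrite inE => /andP[].
  move: szN; rewrite ltnS; apply: leq_trans.
  rewrite (bigD1 x) //= [X in _ < X](bigD1 x) //= eqxx (cardsD1 w (N x)) Nw.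
  by rewrite add1n addSn ltnS leq_add2l; apply: leq_sum => v /negbTE ->.
rewrite negb_exists => /forallP N2.
have hf x : exists y, N x == [set y].
  have /cards1P[y ->] : #|N x| == 1 by have := N1 x; have := N2 x; lia.
  by exists y.
have fE x : N x = [set xchoose (hf x)] by apply/eqP/(xchooseP (hf x)).
exists (fun x => xchoose (hf x)) => [x y|x]; last by rewrite {2}fE inE.
move=> fxy; apply/eqP; apply/negPn/negP => xy.
have /forallP/(_ [set x; y]) := hN.
by rewrite cards2 xy bigcup_setU !big_set1 (fE x) (fE y) fxy setUid cards1.
Qed.

(** Double counting gives Hall's condition: the [#|B| * k] arcs leaving [B] end in [U], and each
    vertex of [U] receives at most [k] of them. *)
Lemma regular_matching (T : finType) (k : nat) (o : rel T) : 0 < k ->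
    (forall x, #|[set y | o x y]| = k) -> (forall y, #|[set x | o x y]| = k) ->
  exists2 f : T -> T, injective f & forall x, o x (f x).
Proof.
move=> k0 ox oy.
have hN : hall_condition (fun x => [set y | o x y]).
  apply/forallP => B; set U := \bigcup_(x in B) _.
  rewrite -(leq_pmul2r k0).
  have -> : #|B| * k = \sum_(x in B) \sum_(y in U) o x y.
    rewrite -sum_nat_const; apply: eq_bigr => x xB.
    rewrite -(ox x) -sum1_card big_mkcond [RHS]big_mkcond /=; apply: eq_bigr => y _.
    rewrite inE; case: ifP => oxy; last by rewrite if_same.
    by have -> : y \in U by apply/bigcupP; exists x; rewrite ?inE.
  rewrite exchange_big /= -sum_nat_const; apply: leq_sum => y _.
  rewrite -(oy y) -sum1_card big_mkcond [X in _ <= X]big_mkcond /=.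
  by apply: leq_sum => x _; rewrite inE; case: (x \in B); case: (o x y).
have [f injf fN] := hall hN.
by exists f => // x; have := fN x; rewrite inE.
Qed.

(** Removing a matching lowers all out- and in-degrees by one. Indexing by [nat] lets the induction
    merely shift indices; from [k] on the maps are dummies. *)
Lemma regular_decomposition (T : finType) (k : nat) (o : rel T) :
    (forall x, #|[set y | o x y]| = k) -> (forall y, #|[set x | o x y]| = k) ->
  exists f : nat -> T -> T, [/\ forall i, injective (f i),
    forall i x, i < k -> o x (f i x) &
    forall i j x, i < j < k -> f i x != f j x].
Proof.
elim: k o => [|k IH] o ox oy.
  by exists (fun=> id); split=> [i|//|i j x /andP[]//]; apply: inj_id.
have [f injf of_] := regular_matching (ltn0Sn k) ox oy.
have [||f' [injf' of' ff']] := IH (fun x y => o x y && (y != f x)).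
- move=> x; have := ox x; rewrite (cardsD1 (f x)) inE of_ => -[<-].
  by apply: eq_card => y; rewrite !inE andbC.
- move=> y; have := oy y.
  rewrite (cardsD1 (finv f y)) inE -{2}(f_finv injf y) of_ => -[<-].
  apply: eq_card => x; rewrite !inE andbC; congr (_ && _).
  by rewrite -(inj_eq injf x) f_finv // eq_sym.
exists (fun i => if i is i'.+1 then f' i' else f).
split=> [[|i] | [|i] x | [|i] [|j] x] //.
- by rewrite ltnS => /of' - /(_ x)/andP[].
- by rewrite ltnS => /of' - /(_ x)/andP[_]; rewrite eq_sym.
- exact: ff'.
Qed.

(** * Cycles and balanced orientations *)

Lemma next_neq_prev (T : eqType) (c : seq T) (x : T) :
  uniq c -> 2 < size c -> x \in c -> next c x != prev c x.
Proof.
move=> Uc sc xc; have [i p Ep] := rot_to xc.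
rewrite -(next_rot i) // -(prev_rot i) //.
have : uniq (rot i c) by rewrite rot_uniq.
have : 2 < size (rot i c) by rewrite size_rot.
rewrite Ep; case: p {Ep} => [|y [|z p]] //= _ /and3P[xp yp _].
rewrite eqxx; apply: contraNneq yp => ->.
move: xp; rewrite !inE !negb_or => /and3P[/negbTE -> /negbTE -> xp].
rewrite -in_cons; elim: p z xp => [z _|w p IH z].
  by rewrite /= eqxx inE.
by rewrite inE negb_or /= => /andP[/negbTE -> /(IH w)]; rewrite !(in_cons z) => ->; rewrite orbT.
Qed.

(** A path is prolonged at its head, which has a second neighbour because its degree is not one. If
    that neighbour is on the path, a cycle closes; this must happen, as [T] is finite. *)
Lemma exists_cycle (T : finType) (e : rel T) (a b : T) :
    symmetric e -> irreflexive e -> (forall x, #|[set y | e x y]| != 1) ->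
    e a b ->
  exists c : seq T, [/\ cycle e c, uniq c & 2 < size c].
Proof.
move=> se ie de eab.
have ext m x y q : #|T| - size q < m -> path e x (y :: q) ->
    uniq [:: x, y & q] ->
    exists c : seq T, [/\ cycle e c, uniq c & 2 < size c].
  elim: m x y q => // m IH x y q szq pq uq.
  have [exy _] := andP pq.
  have [z exz zy] : exists2 z, e x z & z != y.
    apply/exists_inP; apply: contraNT (de x).
    rewrite negb_exists => /forallP h; apply/eqP/(@eq_card1 _ y) => z.
    rewrite !inE; move: (h z); case: (eqVneq z y) => [->|_]; first by [].
    by rewrite andbT => /negbTE.
  have [zq|zq] := boolP (z \in [:: x, y & q]).
    (* [z] differs from both [x] and [y], so the cycle closed at [z] has at least three vertices. *)
    have zq' : z \in q.
      move: zq; rewrite !inE (negbTE zy); case: (eqVneq z x) exz => // ->.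
      by rewrite ie.
    case/splitPr: zq' pq uq => q1 q2 {szq zq} pq uq.
    exists [:: x, y & rcons q1 z]; split.
    - rewrite /= rcons_path last_rcons (se z) exz andbT exy /=.
      by move: pq; rewrite /= exy cat_path rcons_path /= => /and3P[-> ->].
    - have: uniq ([:: x, y & rcons q1 z] ++ q2).
        by rewrite -[_ ++ _]/[:: x, y & rcons q1 z ++ q2] cat_rcons.
      by rewrite cat_uniq => /andP[].
    - by rewrite /= size_rcons.
  apply: (IH z x (y :: q)).
  - by move: szq (max_card (mem [:: x, y & q])); rewrite (card_uniqP uq) /=; lia.
  - by rewrite /= se exz.
  - by rewrite cons_uniq zq.
apply: (ext _ a b [::] (ltnSn _)); rewrite /= ?eab // inE andbT.
by apply: contraTneq eab => ->; rewrite ie.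
Qed.

(* In the proof, a balanced set O of arcs of maximal size covers all edges: the
   uncovered edges form a graph with even degrees, and a cycle in it could be
   added to O. *)
Lemma balanced_orientation (T : finType) (e : rel T) :
    symmetric e -> irreflexive e -> (forall x, ~~ odd #|[set y | e x y]|) ->
  exists o : rel T,
    [/\ forall x y, e x y = o x y || o y x,
        forall x y, o x y -> ~~ o y x
      & forall x, #|[set y | o x y]| = #|[set y | o y x]|].
Proof.
move=> se ie de.
pose out (O : {set T * T}) x := [set y | (x, y) \in O].
pose inn (O : {set T * T}) x := [set y | (y, x) \in O].
have outE O x y : (y \in out O x) = ((x, y) \in O) by rewrite inE.
have innE O x y : (y \in inn O x) = ((y, x) \in O) by rewrite inE.
pose P (O : {set T * T}) :=
  [forall x, forall y, ((x, y) \in O) ==> e x y && ((y, x) \notin O)]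
  && [forall x, #|out O x| == #|inn O x|].
have P0 : P set0.
  apply/andP; split; first by apply/forallP => x; apply/forallP => y; rewrite inE.
  apply/forallP => x; apply/eqP.
  by rewrite !eq_card0 // => y; rewrite !inE.
have PP O : P O -> [/\ forall x y, (x, y) \in O -> e x y,
    forall x y, (x, y) \in O -> (y, x) \notin O & forall x, #|out O x| = #|inn O x|].
  case/andP=> /forallP h1 /forallP h2; split=> [x y|x y|x].
  - by move/forallP: (h1 x) => /(_ y)/implyP h /h /andP[].
  - by move/forallP: (h1 x) => /(_ y)/implyP h /h /andP[].
  - exact/eqP.
case: (@arg_maxnP _ set0 P (fun O => #|O|) P0) => O PO maxO.
have [Oe Oa Ob] := PP O PO.
exists (fun x y => (x, y) \in O); split; [|exact: Oa|exact: Ob].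
pose r x y := [&& e x y, (x, y) \notin O & (y, x) \notin O].
have sr : symmetric r by move=> x y; rewrite /r se [X in _ && X]andbC.
have ir : irreflexive r by move=> x; rewrite /r ie.
(* The edges at [x] covered by [O] number [2 * #|out O x|], so the uncovered degree is even. *)
have dr x : #|[set y | r x y]| != 1.
  have E : [set y | e x y] = [set y | r x y] :|: (out O x :|: inn O x).
    apply/setP=> y; rewrite !inE /r.
    have := Oe x y; have := Oe y x; rewrite (se y).
    by case: (e x y); case: (_ \in O); case: (_ \in O) => // h1 h2;
      do [by have := h1 isT|by have := h2 isT].
  have := de x; rewrite E !cardsU.
  have -> : out O x :&: inn O x = set0.
    by apply/setP=> y; rewrite !inE; apply/negP=> /andP[/Oa/negP].
  have -> : [set y | r x y] :&: (out O x :|: inn O x) = set0.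
    by apply/setP=> y; rewrite !inE /r; case: (_ \in O); case: (_ \in O); rewrite ?andbF.
  rewrite cards0 !subn0 Ob; case: eqP => // ->; rewrite addnn /=.
  by rewrite odd_double.
move=> x y; apply/idP/orP => [exy|[/Oe//|/Oe]]; last by rewrite se.
apply/orP; apply/negPn/negP; rewrite negb_or => nO.
have rxy : r x y by rewrite /r exy.
have [c [cc uc sc]] := exists_cycle sr ir dr rxy.
pose C := [set p : T * T | (p.1 \in c) && (p.2 == next c p.1)].
have Cr u v : (u, v) \in C -> r u v.
  by rewrite inE /= => /andP[uc' /eqP ->]; apply: next_cycle.
have CE u v : (u, v) \in C = (v \in c) && (u == prev c v).
  rewrite inE /=; apply/andP/andP => -[h /eqP ->].
    by rewrite mem_next h prev_next.
  by rewrite mem_prev h next_prev.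
have CO p : p \in C -> p \notin O.
  by case: p => u v /Cr /and3P[].
have : #|O :|: C| <= #|O|.
  apply: maxO; apply/andP; split.
    apply/forallP=> u; apply/forallP=> v; apply/implyP; rewrite !in_setU => /orP[h|h].
      rewrite (Oe _ _ h) negb_or (Oa _ _ h) /=.
      by apply/negP=> /Cr /and3P[_ _ /negP].
    have /and3P[-> h2 h3] := Cr _ _ h; rewrite negb_or h3 /=.
    (* Two opposite arcs in [C] would make [u] both the predecessor and the successor of [v] on
       [c]. *)
    apply/negP; move: h; rewrite CE inE /= => /andP[vc /eqP uE] /andP[_ /eqP uE'].
    by have := next_neq_prev uc sc vc; rewrite -uE -uE' eqxx.
  (* Each vertex of [c] gains one outgoing and one incoming arc, every other vertex none. *)
  apply/forallP=> u; apply/eqP.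
  have -> : out (O :|: C) u = out O u :|: out C u by apply/setP=> v; rewrite !inE.
  have -> : inn (O :|: C) u = inn O u :|: inn C u by apply/setP=> v; rewrite !inE.
  rewrite !cardsU Ob.
  have -> : out O u :&: out C u = set0.
    by apply/setP=> v; rewrite in_setI !outE in_set0; apply/andP=> -[h /CO]; rewrite h.
  have -> : inn O u :&: inn C u = set0.
    by apply/setP=> v; rewrite in_setI !innE in_set0; apply/andP=> -[h /CO]; rewrite h.
  congr (_ + _ - _).
  have -> : out C u = if u \in c then [set next c u] else set0.
    by apply/setP=> v; rewrite !inE /=; case: ifP; rewrite !inE.
  have -> : inn C u = if u \in c then [set prev c u] else set0.
    by apply/setP=> v; rewrite innE CE; case: ifP; rewrite !inE.
  by case: ifP => _; rewrite ?cards1 ?cards0.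
rewrite leqNgt => /negP[]; apply: proper_card.
apply/properP; split; first exact: subsetUl.
case: c cc uc sc @C Cr CE CO => // z c cc uc sc C Cr CE CO.
have zC : (z, next (z :: c) z) \in C by rewrite !inE !eqxx.
by exists (z, next (z :: c) z); [rewrite inE zC orbT|exact: CO].
Qed.

(** * Regular spanning subgraphs and Hamiltonian-like decompositions *)

Lemma bigmin_nat_le (I : finType) (n : nat) (F : I -> nat) (x : I) :
  \big[minn/n]_(y : I) F y <= F x.
Proof.
have : x \in index_enum I by rewrite mem_index_enum.
elim: (index_enum I) => //= y r IH; rewrite inE big_cons.
by case/predU1P=> [<-|/IH]; rewrite geq_min ?leqnn // => ->; rewrite orbT.
Qed.

(** The cycles of the [i]-th decomposition are the orbits of [f i], one for each root. They share no
    edge: the orientation determines the tail [x] of an edge [[set x; f i x]], and then its head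
    determines [i]. *)
Lemma regular_kHLD (G : sgraph) (k : nat) (F : rel G) :
    symmetric F -> (forall x y, F x y -> edge x y) ->
    (forall x, #|[set y | F x y]| = 2 * k) ->
  kHLD k G.
Proof.
move=> sF Fe dF.
have iF : irreflexive F.
  by move=> x; apply/negP=> /Fe; rewrite edge_irrefl.
have [|o [Fo ao bo]] := balanced_orientation sF iF.
  by move=> x; rewrite dF mul2n odd_double.
have dout x : #|[set y | o x y]| = k.
  have := dF x.
  have -> : [set y | F x y] = [set y | o x y] :|: [set y | o y x].
    by apply/setP=> y; rewrite !inE Fo.
  rewrite cardsU -bo [X in _ - X]eq_card0 => [|y]; first by lia.
  by rewrite !inE; apply/negP=> /andP[/ao/negP].
have din y : #|[set x | o x y]| = k by rewrite -bo dout.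
have [f [injf of_ ff]] := regular_decomposition dout din.
have fe (i : 'I_k) x : edge x (f i x) by apply: Fe; rewrite Fo of_.
have ff' (i j : 'I_k) x : f i x = f j x -> i = j.
  move=> fx; apply: val_inj => /=; have := ff i j x; have := ff j i x.
  by rewrite fx eqxx !ltn_ord !andbT; case: (ltngtP i j) => // _ h1 h2;
    [have := h2 isT|have := h1 isT].
pose rts (i : 'I_k) := enum (froots (f i)).
pose rt (i : 'I_k) (s : 'I_(size (rts i))) := tnth (in_tuple (rts i)) s.
pose V (i : 'I_k) s : {set G} := [set y in orbit (f i) (rt i s)].
(* The subgraphs are induced on the orbits; only the chosen cycles, not these subgraphs, must be
   edge-disjoint. *)
have sube_sym (i : 'I_k) s : symmetric [rel x y | [&& x \in V i s, y \in V i s & edge x y]].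
  by move=> x y /=; rewrite edge_sym andbCA.
have subeP (i : 'I_k) s x y : [rel x y | [&& x \in V i s, y \in V i s & edge x y]] x y ->
  [/\ x \in V i s, y \in V i s & edge x y] by move=> /= /and3P[].
pose D (i : 'I_k) s := Subgraph (@sube_sym i s) (@subeP i s).
pose C (i : 'I_k) s := orbit (f i) (rt i s).
have rtP (i : 'I_k) s : froots (f i) (rt i s).
  by have := mem_tnth s (in_tuple (rts i)); rewrite mem_enum.
have rt_inj (i : 'I_k) : injective (rt i).
  by apply/(tuple_uniqP (in_tuple (rts i))); rewrite enum_uniq.
have Vroot (i : 'I_k) s y : y \in V i s -> froot (f i) y = rt i s.
  rewrite inE -fconnect_orbit => c; have /eqP <- := rtP i s.
  by apply/esym/(rootP (fconnect_sym (injf i))).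
have hC (i : 'I_k) s : hamiltonian_cycle (D i s) (C i s).
  split.
  (* An orbit of length one would give a loop, one of length two a pair of opposite arcs of [o]. *)
  - have : uniq [:: rt i s; f i (rt i s); f i (f i (rt i s))].
      have h x : x != f i x.
        by apply: contraTneq (fe i x) => <-; rewrite edge_irrefl.
      rewrite /= !inE negb_or !h /= andbT.
      apply/eqP=> E; have := of_ i (f i (rt i s)) (ltn_ord i).
      by rewrite -E; apply/negP/ao/of_.
    move/uniq_leq_size; apply => y; rewrite !inE -fconnect_orbit.
    by case/or3P=> /eqP->; [exact: connect0|exact: (fconnect_iter _ 1)|
       exact: (fconnect_iter _ 2)].
  - rewrite /ucycle orbit_uniq andbT.
    apply: (sub_in_cycle (P := mem (C i s)) (e := frel (f i))); last first.
    + exact: cycle_orbit.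
    + exact/allP.
    move=> x y xc yc /= /eqP <-; rewrite !inE.
    by rewrite xc mem_orbit // fe.
  - by move=> y; rewrite inE.
exists (fun i => size (rts i)), D, C; split=> //.
  move=> i; split.
  - by move=> s; exists (C i s).
  - move=> s r; apply: contraNT => /pred0Pn[y /= /andP[/Vroot E1 /Vroot E2]].
    by apply/eqP/rt_inj; rewrite -E1.
  - apply/setP=> y; rewrite inE; apply/bigcupP.
    have yr : froot (f i) y \in rts i.
      by rewrite mem_enum; apply: roots_root; apply: fconnect_sym.
    have /tnthP[s Es] : froot (f i) y \in in_tuple (rts i) by [].
    exists s => //=; rewrite inE -fconnect_orbit /rt -Es.
    by rewrite fconnect_sym //; apply: connect_root.
move=> i j s r; apply: contraNT => /pred0Pn[e /= /andP[]].
have nextf (l : 'I_k) q x : x \in C l q -> next (C l q) x = f l x.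
  by move=> xc; apply/esym/eqP/(next_cycle (cycle_orbit (injf l) _) xc).
case/imsetP=> x xc ->; case/imsetP=> y yc; rewrite !nextf // => E.
(* Otherwise [x = f j y] and [y = f i x], so [o] contains two opposite arcs. *)
have Exy : x = y.
  have : x \in [set y; f j y] by rewrite -E !inE eqxx.
  rewrite !inE => /predU1P[//|/eqP xE].
  have : y \in [set x; f i x] by rewrite E !inE eqxx.
  rewrite !inE => /predU1P[//|/eqP yE].
  have := of_ i x (ltn_ord i); rewrite -yE {1}xE => /ao/negP[].
  by apply: of_.
rewrite -{}Exy in yc E *.
have Eij : i = j.
  apply: (ff' _ _ x); have : f i x \in [set x; f j x] by rewrite -E !inE eqxx orbT.
  rewrite !inE => /predU1P[fx|/eqP//].
  by have := fe i x; rewrite fx edge_irrefl.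
case: j / Eij r yc {E} => r yc; apply/eqP; congr (Tagged _ _); apply: rt_inj.
by rewrite -(Vroot i s x) ?inE // (Vroot i r x) ?inE.
Qed.

(** [F] joins each vertex to its two neighbours on each of the [k] cycles through it. These [2 * k]
    neighbours are distinct because the cycles share no edge and have length at least three. *)
Lemma kHLD_regular (G : sgraph) (k : nat) : kHLD k G ->
  exists F : rel G, [/\ symmetric F, forall x y, F x y -> edge x y &
    forall x, #|[set y | F x y]| = 2 * k].
Proof.
case=> t [D [C [hD hC dC]]].
have cov i x : exists s, x \in C i s.
  have [_ _ /setP/(_ x)] := hD i; rewrite inE => /bigcupP[s _ xs].
  by exists s; have [_ _ ->] := hC i s.
pose ix i x := xchoose (cov i x).
have ixP i x : x \in C i (ix i x) := xchooseP (cov i x).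
(* Within one decomposition the cycles are vertex-disjoint, so all vertices of a cycle select the
   same index. *)
have ixE i x y : y \in C i (ix i x) -> ix i y = ix i x.
  move=> yc; apply/eqP/negPn/negP=> nq.
  have [_ /(_ _ _ nq)/disjointFr dj _] := hD i.
  have [_ _ E1] := hC i (ix i y); have [_ _ E2] := hC i (ix i x).
  by have := dj y; rewrite -E1 -E2 ixP yc => /(_ isT).
pose c i x := C i (ix i x).
have uc i x : uniq (c i x) by have [_ /andP[]] := hC i (ix i x).
have sc i x : 2 < size (c i x) by have [] := hC i (ix i x).
pose nb x (p : 'I_k * bool) := if p.2 then next (c p.1 x) x else prev (c p.1 x) x.
have nb_c x p : nb x p \in c p.1 x.
  by rewrite /nb; case: ifP => _; rewrite ?mem_next ?mem_prev ixP.
(* Going back along the same cycle, with the direction bit flipped, returns to [x]; this makes [F]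
   symmetric. *)
have nb_sym x p : x = nb (nb x p) (p.1, ~~ p.2).
  rewrite {1}/nb /c (ixE _ _ _ (nb_c x p)) -/(c _ x) /nb /=.
  by case: p.2 => /=; rewrite ?prev_next ?next_prev.
have nb_edge x p : [set x; nb x p] \in cycle_edges (c p.1 x).
  apply/imsetP; rewrite /nb; case: ifP => _; first by exists x; first exact: ixP.
  exists (prev (c p.1 x) x); first by rewrite mem_prev ixP.
  by rewrite next_prev // setUC.
have nb_inj x : injective (nb x).
  move=> [i b] [j b'] E; have Eij : i = j.
    apply/eqP/negPn/negP=> nij.
    have ntag : Tagged (fun i => 'I_(t i)) (ix i x) != Tagged (fun i => 'I_(t i)) (ix j x).
      by apply: contraNneq nij => /(congr1 tag)/= ->.
    have /disjointFr/(_ (nb_edge x (i, b))) := dC _ _ _ _ ntag.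
    by rewrite E nb_edge.
  move: E; rewrite -{}Eij => E; congr (_, _).
  have := next_neq_prev (uc i x) (sc i x) (ixP i x).
  by move: E; rewrite /nb /=; case: b b' => -[] // ->; rewrite eqxx.
exists (fun x y => y \in codom (nb x)); split.
- suff S x y : y \in codom (nb x) -> x \in codom (nb y).
    by move=> x y; apply/idP/idP; apply: S.
  by case/codomP=> p ->; rewrite {1}(nb_sym x p) codom_f.
- move=> x y /codomP[p ->]; have [_ /andP[cyc _] _] := hC p.1 (ix p.1 x).
  rewrite /nb; case: ifP => _.
    by have /sub_edgeP[] := next_cycle cyc (ixP p.1 x).
  by have /sub_edgeP[_ _] := prev_cycle cyc (ixP p.1 x); rewrite edge_sym.
- move=> x; rewrite cardsE card_codom // card_prod card_ord card_bool mulnC.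
  by [].
Qed.

(** * Dominating sets of the inflation *)

Definition clique_part (G : sgraph) (S : {set inflation G}) (x : G) :
    {set inflation G} :=
  [set u in S | (val u).1 == x].

Lemma card_clique_part (G : sgraph) (S : {set inflation G}) (F : rel G) (x : G) :
    (forall x y, F x y = [exists u in S, val u == (x, y)]) ->
  #|clique_part S x| = #|[set y | F x y]|.
Proof.
move=> FE.
have -> : [set y | F x y] = [set (val u).2 | u in clique_part S x].
  apply/setP=> y; rewrite inE FE.
  apply/exists_inP/imsetP=> [[u uS /eqP Eu]|[u]].
    by exists u; rewrite ?inE ?uS Eu ?eqxx.
  rewrite inE => /andP[uS /eqP <-] ->; exists u => //.
  by rewrite -surjective_pairing.
rewrite card_in_imset // => u v; rewrite !inE => /andP[_ /eqP u1] /andP[_ /eqP v1] E.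
by apply: val_inj; rewrite (surjective_pairing (val u)) u1 -v1 E -surjective_pairing.
Qed.

Lemma sum_clique_part (G : sgraph) (S : {set inflation G}) :
  #|S| = \sum_(x : G) #|clique_part S x|.
Proof.
rewrite -sum1_card (partition_big (fun u : inflation G => (val u).1) xpredT) //=.
by apply: eq_bigr => x _; rewrite -sum1_card; apply: eq_bigl => u; rewrite inE.
Qed.

Lemma twin_subproof (G : sgraph) (u : inflation G) : edge (val u).2 (val u).1.
Proof. by rewrite edge_sym; apply: (valP u). Qed.

(** The only neighbour of [u] outside its own clique. *)
Definition twin (G : sgraph) (u : inflation G) : inflation G :=
  exist (fun p : G * G => edge p.1 p.2) ((val u).2, (val u).1) (twin_subproof u).

(** A vertex sees the rest of its clique and its twin; adding [v \in S] on the left avoids a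
    subtraction. *)
Lemma card_neighbours (G : sgraph) (S : {set inflation G}) (v : inflation G) :
  #|[set u in S | edge v u]| + (v \in S) =
  #|clique_part S (val v).1| + (twin v \in S).
Proof.
have -> : [set u in S | edge v u] =
    (clique_part S (val v).1 :\ v) :|: (S :&: [set twin v]).
  apply/setP=> u; rewrite !inE /= /inflated_edge.
  have -> : (u == twin v) = ((val v).1 == (val u).2) && ((val v).2 == (val u).1).
    by rewrite -val_eqE /= [val u]surjective_pairing xpair_eqE andbC
      (eq_sym (val u).1) (eq_sym (val u).2).
  by case: (u \in S); rewrite ?andbF //= (eq_sym v) (eq_sym (val v).1) andbC.
rewrite cardsU [X in _ - X]eq_card0 => [|u]; last first.
  rewrite !inE; apply/negP=> /andP[/and3P[_ _ /eqP E] /andP[_ /eqP E']].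
  by have := valP v; move: E; rewrite E' /= => ->; rewrite edge_irrefl.
rewrite subn0 addnAC.
have -> : #|S :&: [set twin v]| = (twin v \in S).
  have [tS|tS] := boolP (twin v \in S).
    by rewrite (setIidPr _) ?sub1set // cards1.
  by apply/eqP; rewrite cards_eq0 setI_eq0 disjoint_sym disjoints1.
by rewrite [in RHS](cardsD1 v) inE eqxx andbT [_ + #|_|]addnC.
Qed.

Lemma ktuple_total_dominatingP (G : sgraph) (k : nat) (S : {set inflation G}) :
  reflect (forall v, k + (v \in S) <= #|clique_part S (val v).1| + (twin v \in S))
    (ktuple_total_dominating k S).
Proof.
apply: (iffP forallP) => h v; have := h v.
  by rewrite -card_neighbours leq_add2r.
by rewrite -card_neighbours leq_add2r.
Qed.

(** A vertex of [S] in the clique needs at least [k - 1] others there. If there is none, a vertex of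
    the clique has at most its twin as neighbour in [S], too few for [1 < k]. *)
Lemma leq_card_clique_part (G : sgraph) (k : nat) (S : {set inflation G}) (x : G) :
  1 < k -> k <= degree x -> ktuple_total_dominating k S -> k <= #|clique_part S x|.
Proof.
move=> k_gt1 k_deg /ktuple_total_dominatingP domS.
have [c0|[v]] := set_0Vmem (clique_part S x); last first.
  rewrite inE => /andP[vS /eqP <-]; have := domS v; rewrite vS.
  by case: (_ \in S); lia.
have /card_gt0P[y] : 0 < degree x by lia.
rewrite inE => exy.
have := domS (exist (fun p : G * G => edge p.1 p.2) (x, y) exy).
by rewrite /= c0 cards0; case: (_ \in S); case: (_ \in S); lia.
Qed.

Lemma dominating_setT (G : sgraph) (k : nat) :
  (forall x : G, k <= degree x) -> ktuple_total_dominating k [set: inflation G].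
Proof.
move=> k_degree; apply/ktuple_total_dominatingP=> v; rewrite !in_setT leq_add2r.
rewrite (@card_clique_part _ _ (@edge G)); first exact: k_degree.
move=> x y; apply/idP/exists_inP => [exy|[u _ /eqP uE]].
  by exists (exist (fun p : G * G => edge p.1 p.2) (x, y) exy); rewrite ?inE.
by have := valP u; rewrite uE.
Qed.

Lemma domination_number_eq (G : sgraph) (k : nat) :
    1 < k -> (forall x : G, k <= degree x) ->
  ktuple_total_domination_number k (inflation G) = k * #|G| <->
  exists F : rel G, [/\ symmetric F, forall x y, F x y -> edge x y &
    forall x, #|[set y | F x y]| = k].
Proof.
move=> k_gt1 k_degree; rewrite /ktuple_total_domination_number.
(* The full vertex set is dominating, so [S0] is a genuine minimum and not a default value. *)
case: arg_minnP => [|S0 dS0 minS0]; first exact: dominating_setT.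
have sumk : k * #|G| = \sum_(x : G) k by rewrite sum_nat_const mulnC.
have geS (S : {set inflation G}) : ktuple_total_dominating k S -> k * #|G| <= #|S|.
  move=> dS; rewrite sumk (sum_clique_part S); apply: leq_sum => x _.
  exact: leq_card_clique_part.
split=> [cS0|[F [sF Fe dF]]].
  have eqk x : #|clique_part S0 x| = k.
    (* Equality of the sums forces equality in each of the termwise bounds. *)
    have h (y : G) : true -> k <= #|clique_part S0 y| ?= iff (#|clique_part S0 y| == k).
      by move=> _; split; [exact: leq_card_clique_part|rewrite eq_sym].
    have [_] := leqif_sum h.
    rewrite -sumk -(sum_clique_part S0) cS0 eqxx => /esym/forallP/(_ x).
    by move/eqP.
  (* A vertex of [S0] has only [k - 1] neighbours of [S0] in its clique, so its twin must supply the
     last one. *)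
  have twinS v : v \in S0 -> twin v \in S0.
    move=> vS; have /ktuple_total_dominatingP/(_ v) := dS0.
    by rewrite eqk vS leq_add2l; case: (_ \in _).
  pose F x y := [exists u in S0, val u == (x, y)].
  exists F; split=> [x y|x y|x].
  - suff S x' y' : F x' y' -> F y' x' by apply/idP/idP; apply: S.
    case/exists_inP=> u /twinS tS /eqP uE; apply/exists_inP.
    by exists (twin u); rewrite //= uE.
  - by case/exists_inP=> u _ /eqP uE; have := valP u; rewrite uE.
  - by rewrite -(eqk x); apply/esym/card_clique_part.
pose S : {set inflation G} := [set u | F (val u).1 (val u).2].
have cS x : #|clique_part S x| = k.
  rewrite -(dF x); apply: card_clique_part => {}x y.
  apply/idP/exists_inP=> [Fxy|[u]]; last by rewrite inE => + /eqP uE; rewrite uE.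
  exists (exist (fun p : G * G => edge p.1 p.2) (x, y) (Fe _ _ Fxy)) => //.
  by rewrite inE.
have dS : ktuple_total_dominating k S.
  (* As [F] is symmetric, [v] and its twin lie in [S] together and their contributions cancel. *)
  by apply/ktuple_total_dominatingP => v; rewrite cS !inE /= sF.
apply/eqP; rewrite eqn_leq geS // andbT; apply: leq_trans (minS0 _ dS) _.
by rewrite sumk (sum_clique_part S); apply: leq_sum => x _; rewrite cS.
Qed.

Theorem theorem2p4 (G : sgraph) (n k : nat)
    (hn : #|G| = n) (hk : 1 <= 2 * k <= min_degree G) :
  ktuple_total_domination_number (2 * k) (inflation G) = 2 * k * n
  <-> kHLD k G.
Proof.
case/andP: hk => k_gt0 k_deg.
rewrite -hn domination_number_eq; first last.
- by move=> x; apply: leq_trans k_deg _; apply: bigmin_nat_le.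
(* A positive even number exceeds one. *)
- by lia.
by split=> [[F [sF Fe dF]]|]; [apply: regular_kHLD dF|apply: kHLD_regular].
Qed.
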